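(* Let $G=(V,E)$ be a graph. Then the maximum co-lex relation $\le_G$ on $G$ can be computed in $O(|E|^2)$ time.
   Context: $\Sigma$ is a finite alphabet with a fixed total order $\preceq$. A graph is $G=(V,E)$ with $V$ finite and $E\subseteq V\times V\times\Sigma$. Let $\#\notin\Sigma$ with $\#\prec a$ for all $a\in\Sigma$. For $v\in V$, $\lambda(v)$ is the set of labels of edges entering $v$ if $v$ has incoming edges, and $\{\#\}$ otherwise. Write $\lambda(u)\,\angle\,\lambda(v)$ iff $a\preceq b$ for all $a\in\lambda(u)$, $b\in\lambda(v)$. A co-lex relation on $G$ is a reflexive relation $R\subseteq V\times V$ such that (Axiom 1) if $u\neq v$ and $(u,v)\in R$ then $\lambda(u)\,\angle\,\lambda(v)$; (Axiom 2) for all $(u',u,a),(v',v,a)\in E$ with $u\neq v$ and $(u,v)\in R$, $(u',v')\in R$. The maximum co-lex relation $\le_G$ is the co-lex relation containing every co-lex relation on $G$ (it exists). *)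

(* Defs.v *)
From HB Require Import structures.
From mathcomp Require Import all_boot all_order.

Set Implicit Arguments.
Unset Strict Implicit.
Unset Printing Implicit Defensive.

Section CoLex.
Variables (d : Order.disp_t) (Sigma : finOrderType d) (V : finType).

(* An edge (u, v, a) goes from u to v and is labelled a. *)
Implicit Types (E : {set V * V * Sigma}) (R : {set V * V}).

(* The extended alphabet is option Sigma; None is the character #. *)
Definition char_le (x y : option Sigma) : bool :=
  match x, y with
  | None, _ => true
  | Some _, None => false
  | Some a, Some b => (a <= b)%O
  end.

Definition in_labels E (v : V) : {set Sigma} :=
  [set a | [exists u, (u, v, a) \in E]].

Definition lambda E (v : V) : {set option Sigma} :=
  if in_labels E v == set0 then [set None]
  else [set Some a | a in in_labels E v].

Definition angle (A B : {set option Sigma}) : Prop :=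
  forall x y, x \in A -> y \in B -> char_le x y.

Definition colex_relation E R : Prop :=
  [/\ forall u, (u, u) \in R,
      forall u v, u <> v -> (u, v) \in R -> angle (lambda E u) (lambda E v)
    & forall u' u v' v a, (u', u, a) \in E -> (v', v, a) \in E ->
        u <> v -> (u, v) \in R -> (u', v') \in R].

Definition maximum_colex_relation E R : Prop :=
  colex_relation E R /\ forall R', colex_relation E R' -> R' \subset R.

Definition no_isolated_vertex E : Prop :=
  forall v, exists2 e, e \in E & e.1.1 = v \/ e.1.2 = v.

End CoLex.

(* Word RAM with w-bit words, programmed in a structured language.  There are
   finitely many registers per program and one memory addressed by words.
   Every node of an evaluated expression and every executed command costs one
   time unit.  A value that does not fit in a word makes the run fail: eval
   returns None and exec has no derivation. *)

Inductive binop := OpAdd | OpSub | OpMul | OpLt | OpEq.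

Inductive expr :=
| Const of nat
| Reg of nat
| Read of expr
| Op of binop & expr & expr.

Inductive cmd :=
| Skip
| Assign of nat & expr
| Write of expr & expr
| Seq of cmd & cmd
| If of expr & cmd & cmd
| While of expr & cmd.

Record state := State { regs : nat -> nat; memory : nat -> nat }.

Definition upd (f : nat -> nat) (i x : nat) : nat -> nat :=
  fun j => if j == i then x else f j.

Definition set_reg (s : state) (i x : nat) := State (upd (regs s) i x) (memory s).
Definition set_memory (s : state) (i x : nat) := State (regs s) (upd (memory s) i x).

Definition binop_sem (o : binop) (x y : nat) : nat :=
  match o with
  | OpAdd => x + y
  | OpSub => x - y
  | OpMul => x * y
  | OpLt => x < y
  | OpEq => x == y
  end.

Definition word (w x : nat) : option nat := if x < 2 ^ w then Some x else None.

Fixpoint eval (w : nat) (s : state) (e : expr) : option nat :=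
  match e with
  | Const k => word w k
  | Reg i => word w (regs s i)
  | Read e1 => obind (fun a => word w (memory s a)) (eval w s e1)
  | Op o e1 e2 =>
      obind (fun x => obind (fun y => word w (binop_sem o x y)) (eval w s e2))
            (eval w s e1)
  end.

Fixpoint ecost (e : expr) : nat :=
  match e with
  | Const _ | Reg _ => 1
  | Read e1 => (ecost e1).+1
  | Op _ e1 e2 => (ecost e1 + ecost e2).+1
  end.

(* exec w c s t s' : from s, program c halts in s' after t time units. *)
Inductive exec (w : nat) : cmd -> state -> nat -> state -> Prop :=
| ExecSkip s : exec w Skip s 1 s
| ExecAssign s i e x : eval w s e = Some x ->
    exec w (Assign i e) s (ecost e).+1 (set_reg s i x)
| ExecWrite s e1 e2 a x : eval w s e1 = Some a -> eval w s e2 = Some x ->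
    exec w (Write e1 e2) s (ecost e1 + ecost e2).+1 (set_memory s a x)
| ExecSeq c1 c2 s1 s2 s3 t1 t2 : exec w c1 s1 t1 s2 -> exec w c2 s2 t2 s3 ->
    exec w (Seq c1 c2) s1 (t1 + t2).+1 s3
| ExecIf e c1 c2 s s' x t : eval w s e = Some x ->
    exec w (if x != 0 then c1 else c2) s t s' ->
    exec w (If e c1 c2) s (ecost e + t).+1 s'
| ExecWhileStop e c s : eval w s e = Some 0 ->
    exec w (While e c) s (ecost e).+1 s
| ExecWhileStep e c s1 s2 s3 x t1 t2 : eval w s1 e = Some x -> x != 0 ->
    exec w c s1 t1 s2 -> exec w (While e c) s2 t2 s3 ->
    exec w (While e c) s1 (ecost e + t1 + t2).+1 s3.

Section InputOutput.
Variables (d : Order.disp_t) (Sigma : finOrderType d) (V : finType).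
Implicit Types (E : {set V * V * Sigma}) (R : {set V * V}).

Definition edge_listing E (es : seq (V * V * Sigma)) : Prop :=
  uniq es /\ es =i E.

(* Register 0 holds |V|, register 1 holds |E|, the memory starts with three
   words per edge, and everything else is 0.  Vertices are coded by their
   index, labels by their rank in the order of the alphabet. *)
Definition input_state (es : seq (V * V * Sigma)) : state :=
  let words := flatten
    [seq [:: val (enum_rank e.1.1); val (enum_rank e.1.2);
             val (Order.enum_rank e.2)] | e <- es] in
  State (upd (upd (fun=> 0) 0 #|V|) 1 (size es)) (nth 0 words).

(* Words have at least C log N bits, N being the size of the instance. *)
Definition admissible_word_size (C : nat) E (w : nat) : Prop :=
  C * up_log 2 (#|V| + #|E| + #|Sigma| + 2) <= w.

(* The run of build takes time at most T, after which query decides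
   membership of any pair in R in time at most C. *)
Definition computes_lookup (build query : cmd) (C T : nat) E R : Prop :=
  forall es w, edge_listing E es -> admissible_word_size C E w ->
  exists t s,
    [/\ exec w build (input_state es) t s, t <= T
      & forall u v : V, exists t' s',
          [/\ exec w query
                (set_reg (set_reg s 0 (enum_rank u)) 1 (enum_rank v)) t' s',
              t' <= C & regs s' 0 = ((u, v) \in R)]].

(* The run takes time at most T and leaves the |V| x |V| boolean matrix of R,
   in row-major order, at the address held by register 0. *)
Definition computes_matrix (prog : cmd) (C T : nat) E R : Prop :=
  forall es w, edge_listing E es -> admissible_word_size C E w ->
  exists t s,
    [/\ exec w prog (input_state es) t s, t <= T
      & forall u v : V,
          memory s (regs s 0 + (enum_rank u * #|V| + enum_rank v))
          = ((u, v) \in R)].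

End InputOutput.

(* Main.v *)
Require Import Defs.
From HB Require Import structures.
From mathcomp Require Import all_boot all_order.
From mathcomp Require Import zify.

Set Implicit Arguments.
Unset Strict Implicit.
Unset Printing Implicit Defensive.

(** The complement of the maximum co-lex relation is the least set of pairs
    (the conflicts) that contains the violations of Axiom 1 and is closed under
    passing from [(u', v')] to [(u, v)] when [u <> v] and there are equally
    labelled edges from [u'] to [u] and from [v'] to [v].  It is thus the set of
    pairs reachable from an additional root in a graph on pairs of vertices,
    which has at most three arcs per pair of edges of [G], so a breadth-first
    search takes time [O(|E|^2)].  The conflicts [(u, v)] where [u] has an
    incoming edge and [v] has none may be too numerous if [v] is isolated; an
    isolated [v] propagates nothing, so these are left to the query, which
    consults an array of flags telling which vertices have incoming edges. *)

(** * Weakest preconditions on the word RAM *)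

Fixpoint ev (s : state) (e : expr) : nat :=
  match e with
  | Const k => k
  | Reg i => regs s i
  | Read e1 => memory s (ev s e1)
  | Op o e1 e2 => binop_sem o (ev s e1) (ev s e2)
  end.

(** No intermediate value overflows. The bound [W] stands for [2 ^ w], kept abstract so that the
    side conditions are mostly linear arithmetic. *)
Fixpoint fits (W : nat) (s : state) (e : expr) : Prop :=
  match e with
  | Const k => k < W
  | Reg i => regs s i < W
  | Read e1 => fits W s e1 /\ memory s (ev s e1) < W
  | Op o e1 e2 =>
      [/\ fits W s e1, fits W s e2 & binop_sem o (ev s e1) (ev s e2) < W]
  end.

Lemma eval_fits w s e : fits (2 ^ w) s e -> eval w s e = Some (ev s e).
Proof.
elim: e => [k|i|e IH|o e1 IH1 e2 IH2] /=; rewrite /word.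
- by move->.
- by move->.
- by case=> /IH-> /= ->.
- by case=> /IH1-> /IH2-> /= ->.
Qed.

(* Copies of [upd]: register updates simplify, memory updates do not. *)
Definition rupd (f : nat -> nat) (i x j : nat) : nat :=
  if eqn j i then x else f j.
Definition mupd : (nat -> nat) -> nat -> nat -> nat -> nat := upd.
Arguments rupd f i x j /.
Arguments mupd : simpl never.

Lemma mupd_eq f i x j : j = i -> mupd f i x j = x.
Proof. by move->; rewrite /mupd /upd eqxx. Qed.

Lemma mupd_ne f i x j : j <> i -> mupd f i x j = f j.
Proof. by rewrite /mupd /upd => /eqP/negbTE->. Qed.

(** Meant for loop-free code only, hence [False] for [While]; loops are handled by [runs_while]. *)
Fixpoint wp (W : nat) (c : cmd) (Q : state -> Prop) (s : state) : Prop :=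
  match c with
  | Skip => Q s
  | Assign i e => fits W s e /\ Q (State (rupd (regs s) i (ev s e)) (memory s))
  | Write e1 e2 =>
      [/\ fits W s e1, fits W s e2
        & Q (State (regs s) (mupd (memory s) (ev s e1) (ev s e2)))]
  | Seq c1 c2 => wp W c1 (wp W c2 Q) s
  | If e c1 c2 =>
      [/\ fits W s e, ev s e <> 0 -> wp W c1 Q s & ev s e = 0 -> wp W c2 Q s]
  | While _ _ => False
  end.

Lemma wp_seq W c1 c2 Q s : wp W (Seq c1 c2) Q s = wp W c1 (wp W c2 Q) s.
Proof. by []. Qed.

(** An upper bound independent of the state: a conditional is charged for both branches. The value
    at [While] is immaterial, since [wp] is [False] there. *)
Fixpoint bcost (c : cmd) : nat :=
  match c with
  | Skip => 1
  | Assign _ e => (ecost e).+1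
  | Write e1 e2 => (ecost e1 + ecost e2).+1
  | Seq c1 c2 => (bcost c1 + bcost c2).+1
  | If e c1 c2 => (ecost e + (bcost c1 + bcost c2)).+1
  | While _ _ => 0
  end.

Lemma wp_mono W c (Q Q' : state -> Prop) s :
  wp W c Q s -> (forall s', Q s' -> Q' s') -> wp W c Q' s.
Proof.
elim: c Q Q' s => //= [|i e|e1 e2|c1 IH1 c2 IH2|e c1 IH1 c2 IH2] Q Q' s.
- by move=> Qs; apply.
- by case=> ? Qs QQ'; split=> //; apply: QQ'.
- by case=> ? ? Qs QQ'; split=> //; apply: QQ'.
- by move=> H QQ'; apply: IH1 H _ => s1 H1; apply: IH2 H1 _.
- case=> ? H1 H2 QQ'; split=> //.
  + by move/H1/IH1; apply.
  + by move/H2/IH2; apply.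
Qed.

Definition runs (w : nat) (c : cmd) (s : state) (T : nat) (Q : state -> Prop) :=
  exists t s', [/\ exec w c s t s', t <= T & Q s'].

Lemma runs_wp w c (Q : state -> Prop) s :
  wp (2 ^ w) c Q s -> runs w c s (bcost c) Q.
Proof.
elim: c Q s => //= [|i e|e1 e2|c1 IH1 c2 IH2|e c1 IH1 c2 IH2] Q s.
- by exists 1, s; split=> //; constructor.
- case=> /eval_fits He Qs; do 2 eexists; split; [exact: ExecAssign He| |]; by [].
- case=> /eval_fits He1 /eval_fits He2 Qs.
  do 2 eexists; split; [exact: ExecWrite He1 He2| |]; by [].
- case/IH1=> t1 [s1 [X1 L1 /IH2[t2 [s2 [X2 L2 Qs]]]]].
  exists (t1 + t2).+1, s2; split=> //; first exact: ExecSeq X1 X2.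
  by rewrite ltnS leq_add.
- case=> /eval_fits He H1 H2; have [e0|/eqP e0] := eqVneq (ev s e) 0.
  + have [t [s' [X L Qs]]] := IH2 _ _ (H2 e0).
    exists (ecost e + t).+1, s'; split=> //; last by lia.
    by apply: (ExecIf He); rewrite e0.
  + have [t [s' [X L Qs]]] := IH1 _ _ (H1 e0).
    exists (ecost e + t).+1, s'; split=> //; last by lia.
    by apply: (ExecIf He); move/eqP: e0 => ->.
Qed.

Lemma runs_seq w c1 c2 s T1 T2 (Q1 Q2 : state -> Prop) :
    runs w c1 s T1 Q1 -> (forall s', Q1 s' -> runs w c2 s' T2 Q2) ->
  runs w (Seq c1 c2) s (T1 + T2).+1 Q2.
Proof.
case=> t1 [s1 [X1 L1 /[swap] H /H[t2 [s2 [X2 L2 Qs]]]]].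
exists (t1 + t2).+1, s2; split=> //; first exact: ExecSeq X1 X2.
by rewrite ltnS leq_add.
Qed.

(** The index [k] of the invariant is a variant: it drops at every iteration, so there are at most
    [k] of them, and the final test accounts for [k.+1]. *)
Lemma runs_while w e c (I : nat -> state -> Prop) k s :
    (forall k s, I k s -> fits (2 ^ w) s e /\
       (ev s e <> 0 ->
        wp (2 ^ w) c (fun s' => exists2 k', k' < k & I k' s') s)) ->
    I k s ->
  runs w (While e c) s (k.+1 * (ecost e + bcost c).+1)
    (fun s' => ev s' e = 0 /\ exists k', I k' s').
Proof.
move=> step; elim/ltn_ind: k s => k IH s Ik.
have [/eval_fits He H] := step _ _ Ik.
have [e0|/eqP e0] := eqVneq (ev s e) 0.
  exists (ecost e).+1, s; split; [by apply: ExecWhileStop; rewrite He e0| |].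
    by nia.
  by split=> //; exists k.
have [t1 [s1 [X1 L1 [k' lt_k' Ik']]]] := runs_wp (H e0).
have [t2 [s2 [X2 L2 Q]]] := IH _ lt_k' _ Ik'.
exists (ecost e + t1 + t2).+1, s2; split=> //.
  by apply: ExecWhileStep He _ X1 X2; apply/eqP.
by nia.
Qed.

(** * Conflicts *)

Section Conflicts.
Variables (d : Order.disp_t) (Sigma : finOrderType d) (V : finType).
Variable E : {set V * V * Sigma}.

Definition angle_fails (u v : V) : bool :=
  [exists x, exists y, [&& x \in lambda E u, y \in lambda E v & ~~ char_le x y]].

(* [None] is an additional source, from which the violations of Axiom 1 are
   reached in one step. *)
Definition conflict_step : rel (option (V * V)) := fun x y =>
  match x, y with
  | None, Some (u, v) => (u != v) && angle_fails u v
  | Some (u', v'), Some (u, v) =>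
      (u != v) && [exists a, ((u', u, a) \in E) && ((v', v, a) \in E)]
  | _, None => false
  end.

Definition conflict (x : option (V * V)) : bool := connect conflict_step None x.

Definition max_colex : {set V * V} := [set x | ~~ conflict (Some x)].

Lemma conflict_None : conflict None.
Proof. exact: connect0. Qed.

Lemma conflict_next x y : conflict_step x y -> conflict x -> conflict y.
Proof. by move=> xy Cx; apply: connect_trans Cx (connect1 xy). Qed.

Lemma conflict_ind (P : option (V * V) -> Prop) :
  P None -> (forall x y, conflict_step x y -> P x -> P y) ->
  forall x, conflict x -> P x.
Proof.
move=> P0 PS x /connectP[p + ->].
elim/last_ind: p => [//|p y IH]; rewrite rcons_path last_rcons => /andP[/IH Px].
by move=> /PS; apply.
Qed.

Lemma conflict_neq u v : conflict (Some (u, v)) -> u != v.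
Proof.
suff: forall x, conflict x -> if x is Some (u, v) then u != v else true.
  by move=> H /H.
by apply: conflict_ind => // -[[u' v']|] [[u1 v1]|] //= /andP[].
Qed.

(** Closure of the conflicts under steps gives both axioms by contraposition. Conversely, the
    complement of any co-lex relation contains the violations of Axiom 1 and is closed under steps,
    so it contains every conflict. *)
Lemma max_colexP : maximum_colex_relation E max_colex.
Proof.
split; first split.
- by move=> u; rewrite inE; apply/negP => /conflict_neq; rewrite eqxx.
- move=> u v /eqP uv; rewrite inE => /negP nC x y xu yv.
  apply/negP => /negP nle; apply: nC; apply: conflict_next conflict_None => /=.
  rewrite uv; apply/existsP; exists x; apply/existsP; exists y.
  by rewrite xu yv.
- move=> u' u v' v a eu ev /eqP uv; rewrite !inE; apply: contraNN.
  apply: conflict_next => /=; rewrite uv; apply/existsP; exists a.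
  by rewrite eu ev.
- move=> R [R0 R1 R2]; apply/subsetP => -[u v] uvR; rewrite inE; apply/negP => C.
  suff: forall x, conflict x -> if x is Some y then y \notin R else true.
    by move/(_ _ C); rewrite uvR.
  apply: conflict_ind => // -[[u' v']|] [[u1 v1]|] //= /andP[/eqP uv1].
    case/existsP=> a /andP[e1 e2]; apply: contraNN.
    exact: R2 e1 e2 uv1.
  case/existsP=> x /existsP[y /and3P[xu yv /negP nle]] _.
  by apply/negP => /(R1 _ _ uv1)/(_ x y xu yv).
Qed.

Lemma Some_in_lambda v a :
  Some a \in lambda E v -> exists u, (u, v, a) \in E.
Proof.
rewrite /lambda; case: ifP => _; first by rewrite inE.
by case/imsetP=> b; rewrite inE => /existsP[u ?] [->]; exists u.
Qed.

Lemma edge_in_lambda u v a : (u, v, a) \in E -> Some a \in lambda E v.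
Proof.
move=> e; have: a \in in_labels E v by rewrite inE; apply/existsP; exists u.
rewrite /lambda; case: ifP => [/eqP->|_ ?]; first by rewrite inE.
by apply/imsetP; exists a.
Qed.

Lemma None_in_lambda v :
  (None \in lambda E v) = (in_labels E v == set0).
Proof.
rewrite /lambda; case: ifP => _; first by rewrite inE.
by apply/negP => /imsetP[].
Qed.

(** As # is least, [angle] fails only through two letters in the wrong order or through a letter
    against #, and # occurs at [v] only if [v] has no incoming edge. Both cases are phrased by
    edges, which the program can enumerate. *)
Lemma angle_failsP u v :
  reflect ((exists u' v' a b,
              [/\ (u', u, a) \in E, (v', v, b) \in E & (b < a)%O])
           \/ ((exists u' a, (u', u, a) \in E)
               /\ forall v' b, (v', v, b) \notin E))
          (angle_fails u v).
Proof.
apply: (iffP existsP) => [[x /existsP[y /and3P[]]]|].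
  case: x => [a|//] /Some_in_lambda[u' eu]; case: y => [b|] /=.
    case/Some_in_lambda=> v' ev; rewrite -Order.TotalTheory.ltNge => ba.
    by left; exists u', v', a, b.
  rewrite None_in_lambda => /eqP lv _; right; split; first by exists u', a.
  move=> v' b; apply/negP => ev; have: b \in in_labels E v.
    by rewrite inE; apply/existsP; exists v'.
  by rewrite lv inE.
case=> [[u' [v' [a [b [eu ev ba]]]]]|[[u' [a eu]] nv]].
  exists (Some a); apply/existsP; exists (Some b).
  by rewrite (edge_in_lambda eu) (edge_in_lambda ev) /= -Order.TotalTheory.ltNge.
exists (Some a); apply/existsP; exists None.
rewrite (edge_in_lambda eu) None_in_lambda andbT.
apply/set0Pn => -[b]; rewrite inE => /existsP[v' ev].
by move: (nv v' b); rewrite ev.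
Qed.
End Conflicts.

(** * The program *)

(* Array [k] occupies the addresses from [k * B] on, [B] being in register 2:
   0 input, 1 flags of the vertices with incoming edges, 2 first arc of a key,
   3 next arc with the same source, 4 target of an arc, 5 queue, 6 marks of the
   reached keys.  The key of [(u, v)] is [u * n + v], that of the root is
   [n * n].  Arcs are numbered from 1 in the arrays, 0 ending a list; they are
   indexed from 0 in the proofs.
   Registers: 3, 4 current pair of edges; 5 number of arcs; 6-11 tails, heads
   and labels of the current edges; 12 [n]; 13 [n * n]; 14 next arc to
   traverse; 15, 16 ends of the queue; 18, 19 arc to be added. *)

(* Unlike [do !split], does not unfold the invariants, which are records. *)
Ltac splits := repeat match goal with
  | |- _ /\ _ => split | |- and3 _ _ _ => split | |- and4 _ _ _ _ => split
  | |- and5 _ _ _ _ _ => split end.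

Ltac rewrite_regs :=
  repeat match goal with H : regs _ _ = _ |- _ => rewrite H {H} end.

Definition addr (k : nat) (e : expr) : expr :=
  Op OpAdd (Op OpMul (Const k) (Reg 2)) e.
Definition arr (k : nat) (e : expr) : expr := Read (addr k e).
Definition incr (i : nat) : cmd := Assign i (Op OpAdd (Reg i) (Const 1)).
Definition notE (e : expr) : expr := Op OpSub (Const 1) e.
Definition edge_field (i k : nat) : expr :=
  Read (Op OpAdd (Op OpMul (Const 3) (Reg i)) (Const k)).
Definition pair_key (i j : nat) : expr :=
  Op OpAdd (Op OpMul (Reg i) (Reg 12)) (Reg j).
Definition block : seq cmd -> cmd := foldr Seq Skip.

Arguments addr k e /.
Arguments arr k e /.
Arguments incr i /.
Arguments notE e /.
Arguments edge_field i k /.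
Arguments pair_key i j /.

Definition setup : cmd := block
  [:: Assign 2 (Op OpAdd (Op OpAdd (Reg 0) (Reg 1)) (Const 1));
      Assign 2 (Op OpMul (Const 4) (Op OpMul (Reg 2) (Reg 2)));
      Assign 12 (Reg 0);
      Assign 13 (Op OpMul (Reg 0) (Reg 0))].

Definition heads_cond : expr := Op OpLt (Reg 3) (Reg 1).
Definition heads_body : cmd := block
  [:: Write (addr 1 (edge_field 3 1)) (Const 1); incr 3].

(** Insertion at the front of the list of the source: the former first arc becomes the successor of
    the new one. *)
Definition add_arc : cmd := block
  [:: incr 5; Write (addr 3 (Reg 5)) (arr 2 (Reg 18));
      Write (addr 4 (Reg 5)) (Reg 19); Write (addr 2 (Reg 18)) (Reg 5)].
Definition cond_add (c ks kd : expr) : cmd :=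
  If c (Seq (Assign 18 ks) (Seq (Assign 19 kd) add_arc)) Skip.

Definition arcs_init : cmd := block
  [:: Assign 3 (Const 0); Assign 4 (Const 0); Assign 5 (Const 0)].
Definition arcs_cond : expr := Op OpLt (Reg 3) (Reg 1).
Definition load_edges : cmd := block
  [:: Assign 6 (edge_field 3 0); Assign 7 (edge_field 3 1);
      Assign 8 (edge_field 4 0); Assign 9 (edge_field 4 1);
      Assign 10 (edge_field 3 2); Assign 11 (edge_field 4 2)].
Definition heads_differ : expr := notE (Op OpEq (Reg 7) (Reg 9)).
Arguments heads_differ /.
(** Registers 3 and 4 act as a two-digit counter in base [m], so that a single loop runs through all
    pairs of edges. Products of truth values serve as conjunctions. *)
Definition arcs_body : cmd := block
  [:: load_edges;
      cond_add (Op OpMul (Op OpEq (Reg 10) (Reg 11)) heads_differ)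
               (pair_key 6 8) (pair_key 7 9);
      cond_add (Op OpMul (Op OpLt (Reg 11) (Reg 10)) heads_differ)
               (Reg 13) (pair_key 7 9);
      cond_add (notE (arr 1 (Reg 8))) (Reg 13) (pair_key 7 8);
      incr 4;
      If (Op OpEq (Reg 4) (Reg 1)) (Seq (Assign 4 (Const 0)) (incr 3)) Skip].

Definition search_init : cmd := block
  [:: Write (addr 6 (Reg 13)) (Const 1); Write (addr 5 (Const 0)) (Reg 13);
      Assign 14 (Const 0); Assign 15 (Const 0); Assign 16 (Const 1)].
(** A sum used as a disjunction: the queue is not exhausted, or the current list of arcs is not. *)
Definition search_cond : expr := Op OpAdd (Op OpLt (Reg 15) (Reg 16)) (Reg 14).
(** Each round either traverses one arc or takes one key from the queue, which avoids a nested loop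
    and makes the rounds easy to count. *)
Definition search_body : cmd :=
  If (Reg 14)
    (block [:: Assign 17 (arr 4 (Reg 14)); Assign 14 (arr 3 (Reg 14));
       If (arr 6 (Reg 17)) Skip
         (block [:: Write (addr 6 (Reg 17)) (Const 1);
                    Write (addr 5 (Reg 16)) (Reg 17); incr 16])])
    (block [:: Assign 14 (arr 2 (arr 5 (Reg 15))); incr 15]).

Definition scan : cmd :=
  Seq (While heads_cond heads_body)
 (Seq arcs_init
 (Seq (While arcs_cond arcs_body)
 (Seq search_init (While search_cond search_body)))).

(** In the last summand, there are at most [3 * (m * m)] arcs, the variant of the search starts at
    twice their number plus one, and one more test ends the loop. *)
Definition scan_time (m : nat) : nat :=
  (m.+1 * (ecost heads_cond + bcost heads_body).+1 +
  (bcost arcs_init +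
  ((m * m).+1 * (ecost arcs_cond + bcost arcs_body).+1 +
  (bcost search_init +
   (6 * (m * m)).+2 * (ecost search_cond + bcost search_body).+1).+1).+1).+1).+1.

Definition query : cmd := Assign 0
  (Op OpMul (notE (arr 6 (Op OpAdd (Op OpMul (Reg 0) (Reg 12)) (Reg 1))))
            (notE (Op OpMul (arr 1 (Reg 0)) (notE (arr 1 (Reg 1)))))).

Definition flip_cond : expr := Op OpLt (Reg 3) (Reg 13).
Definition flip_body : cmd := block
  [:: Write (addr 6 (Reg 3)) (notE (arr 6 (Reg 3))); incr 3].
(** Keys number the pairs in row-major order, so complementing the first [n * n] marks in place
    turns array 6 into the matrix of the unreached pairs. *)
Definition flip : cmd :=
  Seq (Assign 3 (Const 0))
 (Seq (While flip_cond flip_body)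
      (Assign 0 (Op OpMul (Const 6) (Reg 2)))).
Definition flip_time (n : nat) : nat :=
  (2 + ((n * n).+1 * (ecost flip_cond + bcost flip_body).+1 + 4).+1).+1.

(** * Linked lists of arcs with a common source *)

Fixpoint last_arc (src : nat -> nat) (k c : nat) : nat :=
  if c is c'.+1 then if src c' == k then c else last_arc src k c' else 0.

Lemma last_arc_le src k c : last_arc src k c <= c.
Proof. by elim: c => //= c IH; case: ifP => // _; lia. Qed.

Lemma last_arc_src src k c :
  last_arc src k c != 0 -> src (last_arc src k c).-1 = k.
Proof. by elim: c => //= c IH; case: ifP => // /eqP. Qed.

Lemma last_arc_max src k c i : i < c -> src i = k -> i < last_arc src k c.
Proof.
elim: c => //= c IH ic si; case: ifP => // sc; apply: IH => //.
have: i <> c by move=> ic'; rewrite -ic' si eqxx in sc.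
by lia.
Qed.

Lemma eq_last_arc src src' k c :
  (forall i, i < c -> src i = src' i) ->
  last_arc src k c = last_arc src' k c.
Proof. by elim: c => //= c IH H; rewrite H // IH // => i ic; apply: H; lia. Qed.

Lemma key_lt n a b : a < n -> b < n -> a * n + b < n * n.
Proof. by nia. Qed.

(** * Invariants of the program, for edges given by their numerical codes *)

Section Program.
Variables (n m B W : nat) (tl hd lb : nat -> nat).
Hypothesis tl_lt : forall i, i < m -> tl i < n.
Hypothesis hd_lt : forall i, i < m -> hd i < n.
Hypothesis lb_lt : forall i, i < m -> lb i < W.
Hypothesis B_gt_n : n < B.
Hypothesis B_gt_nn : n * n < B.
Hypothesis B_gt_m : 3 * m < B.
Hypothesis B_gt_mm : 3 * (m * m) + 2 < B.
(** Array 6 is the last one, so all addresses in use lie below [7 * B]. *)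
Hypothesis W_ge : 8 * B <= W.

Record env (s : state) : Prop := Env {
  env1 : regs s 1 = m;
  env2 : regs s 2 = B;
  env12 : regs s 12 = n;
  env13 : regs s 13 = n * n;
  env_tl : forall i, i < m -> memory s (3 * i + 0) = tl i;
  env_hd : forall i, i < m -> memory s (3 * i + 1) = hd i;
  env_lb : forall i, i < m -> memory s (3 * i + 2) = lb i }.

Lemma env_frame s s' :
    [/\ regs s' 1 = regs s 1, regs s' 2 = regs s 2, regs s' 12 = regs s 12
      & regs s' 13 = regs s 13] ->
    (forall a, a < B -> memory s' a = memory s a) ->
  env s -> env s'.
Proof.
case=> r1 r2 r12 r13 Hm [e1 e2 e3 e4 e5 e6 e7].
by split; rewrite ?r1 ?r2 ?r12 ?r13 // => i im; rewrite Hm ?e5 ?e6 ?e7 //; lia.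
Qed.

Definition has_in (j v : nat) : bool := has (fun i => hd i == v) (iota 0 j).

Definition in_flags (j : nat) (s : state) : Prop :=
  forall v, v < B -> memory s (1 * B + v) = has_in j v.

Definition zero_from (k : nat) (s : state) : Prop :=
  forall a, k * B <= a -> memory s a = 0.

Lemma heads_step j s :
    env s -> in_flags j s -> zero_from 2 s -> regs s 3 = j -> j < m ->
  wp W heads_body (fun s' =>
    [/\ env s', in_flags j.+1 s', zero_from 2 s' & regs s' 3 = j.+1]) s.
Proof.
move=> Es Fs Zs r3 jm; have [e1 e2 e12 e13 e5 e6 e7] := Es.
have := hd_lt jm => hlt.
rewrite /= r3 e2 e6 //; splits; try lia.
- by apply: env_frame Es => //= a aB; rewrite mupd_ne //; lia.
- move=> v vB /=; rewrite /has_in -[j.+1]addn1 iotaD has_cat /= orbF add0n.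
  have [<-|/eqP ne] := eqVneq (hd j) v; first by rewrite mupd_eq // orbT.
  by rewrite mupd_ne ?Fs ?orbF //; lia.
- by move=> a aB /=; rewrite mupd_ne ?Zs //; lia.
Qed.

Definition arc_src (L : seq (nat * nat)) (i : nat) := (nth (0, 0) L i).1.
Definition arc_dst (L : seq (nat * nat)) (i : nat) := (nth (0, 0) L i).2.

(** Since arcs are inserted at the front, the successor of arc [i] is the last arc before [i] with
    the same source. This describes arrays 2 to 4 as a function of [L] alone. *)
Record table (L : seq (nat * nat)) (s : state) : Prop := Table {
  table_size : regs s 5 = size L;
  table_first : forall k, k < B ->
    memory s (2 * B + k) = last_arc (arc_src L) k (size L);
  table_next : forall i, i < size L ->
    memory s (3 * B + i.+1) = last_arc (arc_src L) (arc_src L i) i;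
  table_dst : forall i, i < size L -> memory s (4 * B + i.+1) = arc_dst L i }.

Lemma add_arc_wp L s :
    regs s 2 = B -> table L s -> (size L).+1 < B ->
    regs s 18 < B -> regs s 19 < B ->
  wp W add_arc (fun s' =>
    [/\ table (rcons L (regs s 18, regs s 19)) s',
        forall r, r != 5 -> regs s' r = regs s r
      & forall a, (a < 2 * B) || (5 * B <= a) -> memory s' a = memory s a]) s.
Proof.
move=> e2 [t5 t2 t3 t4] sB x y.
set L' := rcons L _.
have Hl k c :
    c <= size L -> last_arc (arc_src L') k c = last_arc (arc_src L) k c.
  move=> cL; apply: eq_last_arc => i ic.
  by rewrite /arc_src nth_rcons ifT //; lia.
have ll := last_arc_le (arc_src L) (regs s 18) (size L).
rewrite /= t5 e2 t2 //; splits; try lia; last first.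
- by move=> a aB; rewrite !mupd_ne //; lia.
- by move=> r /negbTE; rewrite -eqE /= => ->.
split=> /=; rewrite /L' ?size_rcons /= -/L'; first lia.
- move=> k kB; have -> : arc_src L' (size L) = regs s 18.
    by rewrite /arc_src nth_rcons ltnn eqxx.
  case: eqVneq => [<-|/eqP ne]; first by rewrite mupd_eq //; lia.
  by rewrite !mupd_ne ?t2 ?Hl //; lia.
- move=> i; rewrite ltnS => iL; rewrite Hl // /arc_src nth_rcons.
  have [->|ne] := eqVneq i (size L).
    by rewrite ltnn /= 2?mupd_ne ?mupd_eq //; lia.
  have iL' : i < size L by rewrite ltn_neqAle ne.
  by rewrite iL' !mupd_ne ?t3 //; lia.
- move=> i; rewrite ltnS => iL; rewrite /arc_dst nth_rcons.
  have [->|ne] := eqVneq i (size L).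
    by rewrite ltnn /= mupd_ne ?mupd_eq //; lia.
  have iL' : i < size L by rewrite ltn_neqAle ne.
  by rewrite iL' !mupd_ne ?t4 //; lia.
Qed.

(** [M] is any property insensitive to the registers and arrays that the insertion of an arc
    modifies; it supplies the values of the three expressions and survives for the next
    insertion. *)
Lemma cond_add_wp (M : state -> Prop) c ks kd (b : bool) x y L s :
    (forall s s', (forall r, r \notin [:: 5; 18; 19] -> regs s' r = regs s r) ->
       (forall a, (a < 2 * B) || (5 * B <= a) -> memory s' a = memory s a) ->
       M s -> M s') ->
    (forall s, M s -> [/\ regs s 2 = B, fits W s c, ev s c = b
       & b -> [/\ fits W s ks, ev s ks = x, fits W s kd & ev s kd = y]]) ->
    x < B -> y < B -> (size L).+1 < B -> M s -> table L s ->
  wp W (cond_add c ks kd)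
    (fun s' => M s' /\ table (L ++ if b then [:: (x, y)] else [::]) s') s.
Proof.
move=> Mf Me xB yB sB Ms [t5 t2 t3 t4]; have [e2 fc ec H] := Me _ Ms.
rewrite /cond_add; split=> //; rewrite ec; last first.
  by case: b {Me H ec} => // _; rewrite cats0.
case: b ec Me H => // ec Me /(_ isT)[fks eks fkd ekd] _.
(* [kd] is evaluated after register 18 has been written, so its value has to be obtained from [M] in
   the new state. *)
have M1 : M (State (rupd (regs s) 18 (ev s ks)) (memory s)).
  apply: Mf Ms => //= r.
  by rewrite !inE -eqE; case: (r =P 18) => //; rewrite !orbT.
have [_ _ _ /(_ isT)[_ _ fkd' ekd']] := Me _ M1.
split=> //; split=> //.
set s2 := State _ _; have M2 : M s2.
  apply: Mf M1 => //= r.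
  by rewrite !inE -eqE; case: (r =P 19) => //; rewrite !orbT.
apply: (wp_mono (add_arc_wp (L := L) (s := s2) _ _ _ _ _)) => //=.
- by rewrite eks.
- by rewrite ekd'.
- move=> s' []; rewrite ekd' eks cats1 => T R' M'; split=> //.
  apply: Mf M2 => //= r; rewrite !inE !negb_or => /and3P[r5 r18 r19].
  by rewrite R' // ekd' eks.
Qed.

(** First, Axiom 2 passes a conflict from the tails to the heads. Second, the labels violate Axiom 1
    at the heads. Third, the tail of [f] has no incoming edge while the head of [e] has one; this
    violation is listed only for vertices with an outgoing edge, which keeps the number of arcs
    quadratic in [m]. *)
Definition arcs (e f : nat) : seq (nat * nat) :=
  (if (lb e == lb f) && (hd e != hd f)
   then [:: (tl e * n + tl f, hd e * n + hd f)] else [::]) ++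
  (if (lb f < lb e) && (hd e != hd f)
   then [:: (n * n, hd e * n + hd f)] else [::]) ++
  (if ~~ has_in m (tl f) then [:: (n * n, hd e * n + tl f)] else [::]).

Definition arcs_upto (j : nat) : seq (nat * nat) :=
  flatten [seq arcs (i %/ m) (i %% m) | i <- iota 0 j].

Lemma size_arcs e f : size (arcs e f) <= 3.
Proof. by rewrite /arcs !size_cat; do 3![case: ifP => _]. Qed.

Lemma arcs_uptoS e f : f < m ->
  arcs_upto (e * m + f).+1 = arcs_upto (e * m + f) ++ arcs e f.
Proof.
move=> fm; have m0 : 0 < m := leq_ltn_trans (leq0n f) fm.
rewrite /arcs_upto -[(_ + f).+1]addn1 iotaD map_cat flatten_cat /= cats0 add0n.
by rewrite divnMDl // divn_small // addn0 modnMDl modn_small.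
Qed.

Lemma size_arcs_upto j : size (arcs_upto j) <= 3 * j.
Proof.
elim: j => // j IH.
rewrite /arcs_upto -[j.+1]addn1 iotaD map_cat flatten_cat /= cats0 size_cat.
by have := size_arcs (j %/ m) (j %% m); rewrite -/(arcs_upto j) add0n; lia.
Qed.

Lemma mem_arcs_upto x :
  reflect (exists e f, [/\ e < m, f < m & x \in arcs e f])
          (x \in arcs_upto (m * m)).
Proof.
apply: (iffP flattenP) => [[l /mapP[i]]|[e [f [em fm xef]]]].
  rewrite mem_iota add0n /= => im -> xl; have m0 : 0 < m by case: m im {xl}.
  by exists (i %/ m), (i %% m); rewrite ltn_divLR // ltn_mod.
exists (arcs e f) => //; apply/mapP; exists (e * m + f).
  by rewrite mem_iota key_lt.
have m0 : 0 < m := leq_ltn_trans (leq0n f) fm.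
by rewrite divnMDl // divn_small // addn0 modnMDl modn_small.
Qed.

Lemma arcs_bound e f x : e < m -> f < m -> x \in arcs e f ->
  x.1 <= n * n /\ x.2 < n * n.
Proof.
move=> em fm.
have := (key_lt (tl_lt em) (tl_lt fm), key_lt (hd_lt em) (hd_lt fm),
         key_lt (hd_lt em) (tl_lt fm)).
move=> [[k1 k2] k3]; rewrite /arcs !mem_cat.
by case/or3P; case: ifP => // _; rewrite inE => /eqP-> /=; lia.
Qed.

Record loaded (e f : nat) (s : state) : Prop := Loaded {
  loaded_env : env s;
  loaded_in : in_flags m s;
  loaded_zero : zero_from 5 s;
  loaded3 : regs s 3 = e;
  loaded4 : regs s 4 = f;
  loaded6 : regs s 6 = tl e;
  loaded7 : regs s 7 = hd e;
  loaded8 : regs s 8 = tl f;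
  loaded9 : regs s 9 = hd f;
  loaded10 : regs s 10 = lb e;
  loaded11 : regs s 11 = lb f }.

Lemma loaded_frame e f s s' :
    (forall r, r \notin [:: 5; 18; 19] -> regs s' r = regs s r) ->
    (forall a, (a < 2 * B) || (5 * B <= a) -> memory s' a = memory s a) ->
  loaded e f s -> loaded e f s'.
Proof.
move=> Hr Hm [E F Z l3 l4 l6 l7 l8 l9 l10 l11]; split; rewrite ?Hr //.
- by apply: env_frame E => [|a aB]; [rewrite !Hr|apply: Hm; lia].
- by move=> v vB; rewrite Hm ?F //; lia.
- by move=> a aB; rewrite Hm ?Z // aB orbT.
Qed.

Lemma load_edges_wp e f L s :
    env s -> in_flags m s -> zero_from 5 s -> table L s ->
    regs s 3 = e -> regs s 4 = f -> e < m -> f < m ->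
  wp W load_edges (fun s' => loaded e f s' /\ table L s') s.
Proof.
move=> Es Fs Zs [t5 t2 t3 t4] r3 r4 em fm; have [e1 e2 e12 e13 e5 e6 e7] := Es.
have := (tl_lt em, tl_lt fm, hd_lt em, hd_lt fm, lb_lt em, lb_lt fm).
move=> [[[[[b1 b2] b3] b4] b5] b6].
rewrite /= r3 r4 !e5 // !e6 // !e7 //; splits => //=; lia.
Qed.

Lemma arcs_body_wp e f s :
    env s -> in_flags m s -> zero_from 5 s -> table (arcs_upto (e * m + f)) s ->
    regs s 3 = e -> regs s 4 = f -> e < m -> f < m ->
  wp W arcs_body (fun s' =>
    [/\ env s', in_flags m s', zero_from 5 s',
        table (arcs_upto (e * m + f).+1) s'
      & if f.+1 == m then regs s' 3 = e.+1 /\ regs s' 4 = 0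
        else regs s' 3 = e /\ regs s' 4 = f.+1]) s.
Proof.
move=> Es Fs Zs Ts r3 r4 em fm.
have := (tl_lt em, tl_lt fm, hd_lt em, hd_lt fm, lb_lt em, lb_lt fm).
move=> [[[[[b1 b2] b3] b4] b5] b6].
have := (key_lt (tl_lt em) (tl_lt fm), key_lt (hd_lt em) (hd_lt fm),
         key_lt (hd_lt em) (tl_lt fm)).
move=> [[k1 k2] k3].
(* Room for the at most three arcs of the current pair. *)
have sz : size (arcs_upto (e * m + f)) + 3 < B.
  have := size_arcs_upto (e * m + f); have : (e * m + f).+1 <= m * m by nia.
  lia.
rewrite (arcs_uptoS _ fm) /arcs_body /block /foldr wp_seq.
apply: wp_mono (load_edges_wp Es Fs Zs Ts r3 r4 em fm) _ => s1 [l1 T1].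
rewrite wp_seq; pose bA := (lb e == lb f) && (hd e != hd f).
pose bB := (lb f < lb e) && (hd e != hd f).
pose bC := ~~ has_in m (tl f).
apply: wp_mono (cond_add_wp (M := loaded e f) (b := bA)
  (x := tl e * n + tl f) (y := hd e * n + hd f) _ _ _ _ _ l1 T1) _; try lia.
- exact: loaded_frame.
- move=> {s1 l1 T1} s1 [[]] *; rewrite /bA /=; rewrite_regs.
  by splits => //; try (move=> _; splits); try lia.
move=> s2 [l2 T2]; rewrite wp_seq.
apply: wp_mono (cond_add_wp (M := loaded e f) (b := bB)
  (x := n * n) (y := hd e * n + hd f) _ _ _ _ _ l2 T2) _; try lia.
- exact: loaded_frame.
- move=> {s1 l1 T1 s2 l2 T2} s1 [[]] *; rewrite /bB /=; rewrite_regs.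
  by splits => //; try (move=> _; splits); try lia.
- by rewrite size_cat; case: ifP => _ /=; lia.
move=> s3 [l3 T3]; rewrite wp_seq.
apply: wp_mono (cond_add_wp (M := loaded e f) (b := bC)
  (x := n * n) (y := hd e * n + tl f) _ _ _ _ _ l3 T3) _; try lia.
- exact: loaded_frame.
- move=> {s1 l1 T1 s2 l2 T2 s3 l3 T3} s1 l1; have F1 := loaded_in l1.
  have I1 : memory s1 (1 * B + tl f) = has_in m (tl f) by rewrite F1 //; lia.
  case: l1 => -[] *; rewrite /bC /=; rewrite_regs.
  by rewrite I1; splits => //; try (move=> _; splits); try lia.
- by rewrite !size_cat; do 2![case: ifP => _] => /=; lia.
move=> s4 [l4]; rewrite -!catA -/(arcs e f) => T4.
have [E4 F4 Z4 q3 q4 *] := l4; have := E4 => -[q1 q2 q12 q13 *].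
have [t5 t2 t3 t4] := T4.
have fm' : (f.+1 == m) = (f + 1 == m) by rewrite addn1.
rewrite /= q4 q1 q3 fm'; case: eqP => /= cmp; splits=> //; try lia.
all: by move=> _; splits=> //; try lia; by [apply: env_frame E4|split].
Qed.

(** * Breadth-first search *)

Record searching (L : seq (nat * nat)) (Q : seq nat) (p h : nat)
    (s : state) : Prop := Searching {
  srch_env : env s;
  srch_in : in_flags m s;
  srch_table : table L s;
  srch14 : regs s 14 = p;
  srch15 : regs s 15 = h;
  srch16 : regs s 16 = size Q;
  srch_queue : forall i, i < size Q -> memory s (5 * B + i) = nth 0 Q i;
  srch_mark : forall k, k < B -> memory s (6 * B + k) = (k \in Q) }.

(* [done] is the list of traversed arcs, [kc] the key whose arcs are being
   traversed; those of index below [p] still have to be. *)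
Record search_inv (L : seq (nat * nat)) (Q : seq nat) (p h : nat)
    (kc : nat) (done : seq nat) : Prop := SearchInv {
  sinv_uniqQ : uniq Q;
  sinv_root : n * n \in Q;
  sinv_sub : {subset Q <= n * n :: [seq x.2 | x <- L]};
  sinv_least : forall S : nat -> Prop, S (n * n) ->
    (forall x, x \in L -> S x.1 -> S x.2) -> forall k, k \in Q -> S k;
  sinv_head : h <= size Q;
  sinv_p : p <= size L;
  sinv_kc : p != 0 -> arc_src L p.-1 = kc /\ kc \in take h Q;
  sinv_uniq : uniq done;
  sinv_done : forall i, i \in done ->
    [/\ i < size L, arc_src L i \in take h Q, arc_dst L i \in Q
      & ~ (arc_src L i = kc /\ i < p)];
  sinv_todo : forall i, i < size L -> arc_src L i \in take h Q ->
    i \in done \/ arc_src L i = kc /\ i < p }.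

(** The variant counts down traversed arcs and popped keys. Arcs are traversed at most once and the
    queue has no repetition, its keys being the root and targets of arcs, so [size done + h] is at
    most [(2 * size L).+1]. *)
Definition search_loop (L : seq (nat * nat)) (k : nat) (s : state) : Prop :=
  exists Q p h kc done,
    [/\ searching L Q p h s, search_inv L Q p h kc done
      & k = (2 * size L).+1 - (size done + h)].

Lemma size_done L Q p h kc done :
  search_inv L Q p h kc done -> size done <= size L.
Proof.
case=> _ _ _ _ _ _ _ ud dP _; rewrite -(size_iota 0 (size L)).
by apply: uniq_leq_size => // i /dP[iL _ _ _]; rewrite mem_iota.
Qed.

Lemma size_queue L Q p h kc done :
  search_inv L Q p h kc done -> size Q <= (size L).+1.
Proof.
case=> uQ _ sQ _ _ _ _ _ _ _.
by have := uniq_leq_size uQ sQ; rewrite /= size_map.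
Qed.

(** The queue has no repetition, so the popped key is new: none of its arcs is in [done], and its
    whole list is still to be traversed. As [p] is [0], nothing remains of the list of the former
    key. *)
Lemma search_inv_pop L Q h kc done :
    search_inv L Q 0 h kc done -> h < size Q ->
  search_inv L Q (last_arc (arc_src L) (nth 0 Q h) (size L)) h.+1
    (nth 0 Q h) done.
Proof.
case=> uQ rQ sQ lQ hQ pL kcP ud dP tP hlt.
have kt : nth 0 Q h \notin take h Q.
  apply/negP => /(nthP 0)[i]; rewrite size_takel // => ih.
  rewrite nth_take // => /eqP; rewrite nth_uniq // ?(ltn_trans ih) //.
  by move/eqP; lia.
have tS x : (x \in take h.+1 Q) = (x \in take h Q) || (x == nth 0 Q h).
  by rewrite (take_nth 0) // mem_rcons inE orbC.
split=> //.
- exact: last_arc_le.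
- by move=> p0; rewrite last_arc_src // tS eqxx orbT.
- move=> i iD; have [iL st dQ _] := dP _ iD; split=> //; first by rewrite tS st.
  by case=> sk _; rewrite sk (negbTE kt) in st.
- move=> i iL; rewrite tS; case/orP => [/tP|/eqP sk].
    by case/(_ iL) => [|[]//]; left.
  by right; split=> //; apply: last_arc_max.
Qed.

(** The arc numbered [p.+1] has index [p]. The arcs skipped between it and its successor have other
    sources, so the remaining arcs of [kc] are those below the new position. *)
Lemma search_inv_arc L Q p h kc done :
    search_inv L Q p.+1 h kc done ->
  search_inv L (if arc_dst L p \in Q then Q else rcons Q (arc_dst L p))
    (last_arc (arc_src L) (arc_src L p) p) h kc (p :: done).
Proof.
case=> uQ rQ sQ lQ hQ pL /(_ isT)[/= kcE kcT] ud dP tP.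
set k := arc_dst L p; set Q' := if _ then _ else _.
have pL' : (arc_src L p, k) \in L.
  by rewrite /arc_src /k /arc_dst -surjective_pairing mem_nth.
have QQ' x : x \in Q -> x \in Q'.
  by move=> xQ; rewrite /Q'; case: ifP; rewrite // mem_rcons inE xQ orbT.
have Q'E x : x \in Q' -> x \in Q \/ x = k.
  rewrite /Q'; case: ifP => _; first by left.
  by rewrite mem_rcons inE => /predU1P[]; [right|left].
have tQ : take h Q' = take h Q.
  by rewrite /Q'; case: ifP => // _; rewrite -cats1 takel_cat.
have kQ' : k \in Q' by rewrite /Q'; case: ifP; rewrite // mem_rcons inE eqxx.
have pp := last_arc_le (arc_src L) (arc_src L p) p.
split=> //.
- by rewrite /Q'; case: ifP => // kQ; rewrite rcons_uniq kQ.
- exact: QQ'.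
- move=> x /Q'E[/sQ //|->]; rewrite inE; apply/orP; right.
  by apply/mapP; exists (arc_src L p, k).
- move=> S S0 SS x /Q'E[xQ|->]; first exact: lQ.
  by apply: (SS _ pL') => /=; apply: lQ => //; rewrite kcE (mem_take kcT).
- by apply: (leq_trans hQ); rewrite /Q'; case: ifP => // _; rewrite size_rcons.
- by apply: leq_trans pp (ltnW pL).
- by move=> p0; rewrite tQ last_arc_src.
- by rewrite /= ud andbT; apply/negP => /dP[_ _ _]; apply.
- move=> i; rewrite inE tQ => /predU1P[->|iD].
    by split=> //; [rewrite kcE|case=> _; lia].
  have [iL st dQ nk] := dP _ iD; split=> //; first exact: QQ'.
  by case=> sk ip; apply: nk; split=> //; lia.
- move=> i iL; rewrite tQ inE => st.
  have [->|ne] := eqVneq i p; first by left.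
  case: (tP i iL st) => [|[sk ip]]; first by left.
  right; split=> //; apply: last_arc_max; rewrite ?kcE //; lia.
Qed.

Lemma table_frame L s s' :
    (size L).+1 < B -> regs s' 5 = regs s 5 ->
    (forall a, a < 5 * B -> memory s' a = memory s a) ->
  table L s -> table L s'.
Proof.
by move=> sB r5 Hm [t5 t2 t3 t4]; split=> [|k kB|i iL|i iL];
  rewrite ?r5 // Hm ?t2 ?t3 ?t4 //; lia.
Qed.

Lemma searching_frame L Q p h s s' :
    (size L).+1 < B ->
    [/\ regs s' 1 = regs s 1, regs s' 2 = regs s 2, regs s' 5 = regs s 5,
        regs s' 12 = regs s 12 & regs s' 13 = regs s 13] ->
    [/\ regs s' 14 = p, regs s' 15 = h & regs s' 16 = size Q] ->
    (forall a, a < 5 * B -> memory s' a = memory s a) ->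
    (forall i, i < size Q -> memory s' (5 * B + i) = nth 0 Q i) ->
    (forall k, k < B -> memory s' (6 * B + k) = (k \in Q)) ->
    env s -> in_flags m s -> table L s ->
  searching L Q p h s'.
Proof.
move=> sB [r1 r2 r5 r12 r13] [r14 r15 r16] Hm q5 q6 Es Fs Ts; split=> //.
- by apply: env_frame Es => // a aB; apply: Hm; lia.
- by move=> v vB; rewrite Hm ?Fs //; lia.
- exact: table_frame Ts.
Qed.

Lemma search_step (L : seq (nat * nat)) k s :
    (forall x, x \in L -> x.2 < B) -> (size L).+2 < B -> search_loop L k s ->
  fits W s search_cond /\
  (ev s search_cond <> 0 ->
   wp W search_body (fun s' => exists2 k', k' < k & search_loop L k' s') s).
Proof.
move=> LB szB [Q [p [h [kc [done [S I ->]]]]]].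
have szd := size_done I; have szq := size_queue I.
have QB x : x \in Q -> x < B.
  by move/(sinv_sub I); rewrite inE => /predU1P[->//|/mapP[y /LB ? ->]].
have hQ := sinv_head I; have pL := sinv_p I.
have [Es Fs Ts r14 r15 r16 q5 q6] := S; have e2 := env2 Es.
have [t5 t2 t3 t4] := Ts.
split; rewrite /= r14 r15 r16; first by splits; lia.
move=> ne; splits; first lia; last first.
  (* The current list is exhausted, so the next key is popped. *)
  move=> p0; rewrite p0 in I r14 ne => {S}.
  have hlt : h < size Q by move: ne; case: ltnP.
  have nB : nth 0 Q h < B by apply: QB; apply: mem_nth.
  have ll := last_arc_le (arc_src L) (nth 0 Q h) (size L).
  have I' := search_inv_pop I hlt.
  have := sinv_head I' => hQ'.
  rewrite e2 q5 // t2 //; splits; try lia.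
  exists ((2 * size L).+1 - (size done + h.+1)); first lia.
  exists Q, (last_arc (arc_src L) (nth 0 Q h) (size L)), h.+1, (nth 0 Q h), done.
  by split=> //; apply: searching_frame Es Fs Ts => //=; [lia|split=> //; lia].
case: p => [//|p] in I r14 pL {S ne} * => _.
have ll := last_arc_le (arc_src L) (arc_src L p) p.
have I' := search_inv_arc I.
have := size_done I' => /= szd'; have := size_queue I' => szq'.
have dB : arc_dst L p < B by apply: LB; apply: mem_nth.
rewrite e2 t4 // t3 // q6 //.
(* Whether or not the target is new, the arc joins [done], so the variant drops. *)
have fin s' :
    searching L (if arc_dst L p \in Q then Q else rcons Q (arc_dst L p))
      (last_arc (arc_src L) (arc_src L p) p) h s' ->
   exists2 k', k' < (2 * size L).+1 - (size done + h) & search_loop L k' s'.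
  move=> S'; exists ((2 * size L).+1 - ((size done).+1 + h)); first lia.
  by do 5 eexists; split; [exact: S'|exact: I'|].
case: ifP I' szq' fin => dQ I' szq' fin /=; splits; try lia; move=> // _.
  by apply: fin; apply: searching_frame Es Fs Ts => //=; lia.
move: szq'; rewrite size_rcons => szq'; splits; try lia.
apply: fin; apply: searching_frame Es Fs Ts => //=; first lia.
- by split=> //; rewrite size_rcons; lia.
- by move=> a aB; rewrite !mupd_ne //; lia.
- move=> i; rewrite size_rcons ltnS nth_rcons => iQ.
  have [->|ne] := eqVneq i (size Q); first by rewrite ltnn mupd_eq.
  have iQ' : i < size Q by rewrite ltn_neqAle ne.
  by rewrite iQ' !mupd_ne ?q5 //; lia.
- move=> k1 kB; rewrite mem_rcons inE mupd_ne; last by lia.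
  by case: eqVneq => [->|/eqP ne]; [rewrite mupd_eq|rewrite mupd_ne ?q6 //; lia].
Qed.

(** Specifies the reached keys without mention of the search order. Minimality ranges over all
    predicates, so that it can be applied to the codes of conflicts. *)
Definition least_closed (L : seq (nat * nat)) (Q : seq nat) : Prop :=
  [/\ n * n \in Q, forall x, x \in L -> x.1 \in Q -> x.2 \in Q
    & forall S : nat -> Prop, S (n * n) ->
      (forall x, x \in L -> S x.1 -> S x.2) -> forall k, k \in Q -> S k].

Record built (Q : seq nat) (s : state) : Prop := Built {
  built_env : env s;
  built_in : in_flags m s;
  built_mark : forall k, k < B -> memory s (6 * B + k) = (k \in Q) }.

(** A zero condition forces [p = 0] and [h = size Q]: every key of [Q] has been popped, every arc
    leaving [Q] is in [done], and so its target is in [Q]. *)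
Lemma search_end L k s :
  search_loop L k s -> ev s search_cond = 0 ->
  exists2 Q, least_closed L Q & built Q s.
Proof.
case=> [Q [p [h [kc [done [[Es Fs Ts r14 r15 r16 q5 q6] I _]]]]]].
rewrite /= r14 r15 r16 => c0; exists Q; last by split.
have p0 : p = 0 by lia.
have hQ : h = size Q by have := sinv_head I; lia.
case: I => uQ rQ sQ lQ _ _ _ _ dP tP; split=> // x xL x1Q.
have iL : index x L < size L by rewrite index_mem.
have := tP _ iL; rewrite hQ take_size /arc_src nth_index // => /(_ x1Q).
rewrite p0 => -[/dP[_ _ + _]|[]//]; by rewrite /arc_dst nth_index.
Qed.

Lemma search_init_wp L s :
    env s -> in_flags m s -> table L s -> (size L).+1 < B ->
    zero_from 5 s ->
  wp W search_init (search_loop L (2 * size L).+1) s.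
Proof.
move=> Es Fs Ts sB m0; have e2 := env2 Es; have e13 := env13 Es.
rewrite /= e2 e13; splits; try lia.
exists [:: n * n], 0, 0, 0, [::]; split; last by [].
- apply: searching_frame Es Fs Ts => //=.
  + by move=> a aB; rewrite !mupd_ne //; lia.
  + by case=> // _; rewrite mupd_eq.
  + move=> k kB; rewrite inE mupd_ne; last by lia.
    by case: eqVneq => [->|/eqP ne]; [rewrite mupd_eq|rewrite mupd_ne ?m0 //; lia].
- split=> //=; rewrite ?inE //.
  + by move=> x; rewrite !inE => ->.
  + by move=> S S0 _ k; rewrite inE => /eqP->.
Qed.

(** * Running times of the loops and of the whole scan *)

Variable w : nat.
Hypothesis WE : W = 2 ^ w.

Lemma heads_runs s :
    env s -> zero_from 1 s -> regs s 3 = 0 ->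
  runs w (While heads_cond heads_body) s
    (m.+1 * (ecost heads_cond + bcost heads_body).+1)
    (fun s' => [/\ env s', in_flags m s' & zero_from 2 s']).
Proof.
move=> Es Zs r3; pose I k s := exists2 j, k = m - j &
  [/\ env s, in_flags j s, zero_from 2 s, regs s 3 = j & j <= m].
have [||t [s' [X L [+ [k [j _ [E' F' Z' r3' jm]]]]]]] :=
    @runs_while w heads_cond heads_body I m s.
- move=> k {Es Zs r3}s [j -> [Es Fs Zs r3 jm]]; rewrite -WE.
  have e1 := env1 Es; split; first by rewrite /= r3 e1; splits; lia.
  move=> c; have {}jm : j < m by move: c; rewrite /= r3 e1; case: ltnP.
  apply: wp_mono (heads_step Es Fs Zs r3 jm) _ => s' [E' F' Z' r3'].
  by exists (m - j.+1); [lia|exists j.+1].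
- exists 0; first by rewrite subn0.
  split=> //; first by move=> v vB; rewrite Zs //; lia.
  by move=> a aB; rewrite Zs //; lia.
rewrite /= r3' (env1 E') => c; have jE : j = m by lia.
by exists t, s'; split=> //; split=> //; rewrite -jE.
Qed.

Lemma arcs_runs s :
    env s -> in_flags m s -> zero_from 5 s -> table [::] s ->
    regs s 3 = 0 -> regs s 4 = 0 ->
  runs w (While arcs_cond arcs_body) s
    ((m * m).+1 * (ecost arcs_cond + bcost arcs_body).+1)
    (fun s' => [/\ env s', in_flags m s', zero_from 5 s'
                 & table (arcs_upto (m * m)) s']).
Proof.
(* [f < m] can be required only while [e < m]; after the last pair [f] is [0], so that [e * m + f]
   is [m * m]. *)
move=> Es Fs Zs Ts r3 r4; pose I k s := exists e f, k = m * m - (e * m + f) /\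
  ([/\ env s, in_flags m s, zero_from 5 s & table (arcs_upto (e * m + f)) s] /\
  [/\ regs s 3 = e, regs s 4 = f, e < m -> f < m, m <= e -> f = 0 & e <= m]).
have [||t [s' [X L [+ [k [e [f [_ [[E' F' Z' T'] [r3' r4' fm f0 em]]]]]]]]]] :=
    @runs_while w arcs_cond arcs_body I (m * m) s.
- move=> k {Es Fs Zs Ts r3 r4}s [e [f [-> [[Es Fs Zs Ts] [r3 r4 fm f0 em]]]]].
  rewrite -WE; have e1 := env1 Es.
  split; first by rewrite /= r3 e1; splits; lia.
  move=> c; have {}em : e < m by move: c; rewrite /= r3 e1; case: ltnP.
  apply: wp_mono (arcs_body_wp Es Fs Zs Ts r3 r4 em (fm em)) _.
  have {}fm := fm em; have fmm : e * m + f < m * m by nia.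
  move=> s' [E' F' Z' T']; case: eqP => [fE|fE] [r3' r4'].
    exists (m * m - (e.+1 * m + 0)); first by nia.
    exists e.+1, 0; split=> //; split; split=> //; try lia.
    by have <- : (e * m + f).+1 = e.+1 * m + 0 by nia.
  exists (m * m - (e * m + f.+1)); first by nia.
  by exists e, f.+1; split=> //; split; split=> //; try lia; rewrite addnS.
- exists 0, 0; split; first by rewrite subn0.
  by split=> //; split=> //; lia.
rewrite /= r3' (env1 E') => c; have eE : e = m by lia.
exists t, s'; split=> //; split=> //.
by move: T'; rewrite eE f0 ?eE // addn0.
Qed.

Lemma arcs_upto_bound x : x \in arcs_upto (m * m) -> x.1 < B /\ x.2 < B.
Proof.
case/mem_arcs_upto=> e [f [em fm xef]]; have [x1 x2] := arcs_bound em fm xef.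
by split; [apply: leq_ltn_trans x1 _|apply: ltn_trans x2 _].
Qed.

Lemma search_runs (L : seq (nat * nat)) k s :
    (forall x, x \in L -> x.2 < B) -> (size L).+2 < B ->
    search_loop L k s ->
  runs w (While search_cond search_body) s
    (k.+1 * (ecost search_cond + bcost search_body).+1)
    (fun s' => exists2 Q, least_closed L Q & built Q s').
Proof.
move=> LB sB Ls.
have [||t [s' [X T [c [k' L']]]]] :=
    @runs_while w search_cond search_body (search_loop L) k s.
- by move=> k' s' ?; rewrite -WE; apply: search_step.
- by [].
by exists t, s'; split=> //; apply: search_end L' c.
Qed.

Lemma scan_runs s :
    env s -> zero_from 1 s -> regs s 3 = 0 ->
  runs w scan s (scan_time m) (fun s' =>
    exists2 Q, least_closed (arcs_upto (m * m)) Q & built Q s').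
Proof.
move=> Es Zs r3; apply: runs_seq; first exact: heads_runs.
move=> {Es Zs r3}s [Es Fs Zs]; apply: runs_seq.
  apply: (@runs_wp w arcs_init (fun s' =>
    [/\ [/\ env s', in_flags m s', zero_from 5 s' & table [::] s'],
        regs s' 3 = 0 & regs s' 4 = 0])).
  rewrite -WE /=; splits=> //; try lia.
  - by apply: env_frame Es.
  - by move=> a aB; apply: Zs; lia.
  - by split=> //= k kB; rewrite Zs //; lia.
move=> {Es Fs Zs}s [[Es Fs Zs Ts] r3 r4]; apply: runs_seq.
  exact: arcs_runs.
move=> {Es Fs Zs Ts r3 r4}s [Es Fs Zs Ts].
have sz := size_arcs_upto (m * m).
apply: runs_seq.
  apply: runs_wp; rewrite -WE; apply: search_init_wp Es Fs Ts _ Zs; lia.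
move=> {Es Fs Zs Ts}s Ls.
have [||t [s' [X T H]]] := @search_runs _ _ _ _ _ Ls.
- by move=> x /arcs_upto_bound[].
- by lia.
by exists t, s'; split=> //; apply: leq_trans T _; nia.
Qed.

(** * Query and complementation of the marks *)

Definition lookup_value (Q : seq nat) (u v : nat) : bool :=
  (u * n + v \notin Q) && ~~ (has_in m u && ~~ has_in m v).

Lemma query_wp Q s u v : u < n -> v < n -> built Q s ->
  wp W query (fun s' => regs s' 0 = lookup_value Q u v)
    (set_reg (set_reg s 0 u) 1 v).
Proof.
move=> un vn [Es Fs Ms]; have kB := key_lt un vn.
have e2 := env2 Es; have e12 := env12 Es.
change (set_reg _ _ _) with (State (rupd (rupd (regs s) 0 u) 1 v) (memory s)).
have M1 : memory s (6 * B + (u * n + v)) = (u * n + v \in Q) by apply: Ms; lia.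
have F1 : memory s (1 * B + u) = has_in m u by apply: Fs; lia.
have F2 : memory s (1 * B + v) = has_in m v by apply: Fs; lia.
rewrite /= e2 e12 M1 F1 F2 /lookup_value; splits; try lia.
Qed.

Lemma flip_runs Q s : built Q s ->
  runs w flip s (flip_time n) (fun s' => forall k, k < n * n ->
    memory s' (regs s' 0 + k) = (k \notin Q)).
Proof.
move=> [Es Fs Ms]; have e2 := env2 Es; have e13 := env13 Es.
pose I j s := [/\ regs s 2 = B, regs s 13 = n * n, regs s 3 = j, j <= n * n
  & forall k, k < n * n ->
     memory s (6 * B + k) = (if k < j then k \notin Q else k \in Q)].
apply: runs_seq.
  apply: (@runs_wp w _ (I 0)); rewrite -WE /=; splits=> //; try lia.
  by split=> //= k kn; apply: Ms; lia.
move=> {Es Fs Ms e2 e13}s Is; apply: runs_seq.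
  apply: (@runs_while w flip_cond flip_body
            (fun k s => exists2 j, k = n * n - j & I j s)); last first.
    by exists 0; first exact: (esym (subn0 (n * n))).
  move=> k {Is}s [j -> [r2 r13 r3 jn Ms]]; rewrite -WE.
  split; first by rewrite /= r3 r13; splits; lia.
  move=> c; have {}jn : j < n * n by move: c; rewrite /= r3 r13; case: ltnP.
  have := Ms _ jn; rewrite ltnn => Mj.
  rewrite /= r2 r3 Mj; splits; try lia.
  exists (n * n - j.+1); first by lia.
  exists j.+1 => //; split=> //=; first by lia.
  move=> i ni; rewrite ltnS; have [->|ne] := eqVneq i j.
    by rewrite mupd_eq // leqnn; case: (j \in Q).
  by rewrite mupd_ne ?Ms //; [rewrite [i <= j]leq_eqVlt (negbTE ne)|lia].
move=> {Is}s [c [_ [j _ [r2 r13 r3 jn Ms]]]].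
have jE : j = n * n by move: c; rewrite /= r3 r13; lia.
apply: runs_wp; rewrite -WE /= r2; splits; try lia.
by move=> k kn; rewrite Ms // jE kn.
Qed.

End Program.

(** * Correctness *)

Lemma mulnD_inj n a b a' b' :
  b < n -> b' < n -> a * n + b = a' * n + b' -> a = a' /\ b = b'.
Proof.
move=> bn b'n eq; have aa : a = a' by nia.
by split=> //; move: eq; rewrite aa; lia.
Qed.

Lemma nth_triples (T : Type) (a b c : T -> nat) (s : seq T) i :
  let words := flatten [seq [:: a x; b x; c x] | x <- s] in
  [/\ nth 0 words (3 * i + 0) = nth 0 (map a s) i,
      nth 0 words (3 * i + 1) = nth 0 (map b s) i
    & nth 0 words (3 * i + 2) = nth 0 (map c s) i].
Proof.
elim: s i => [|x s IH] i; first by split; rewrite !nth_default.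
case: i => [|i] //; have [IHa IHb IHc] := IH i.
by rewrite mulnS !addSn /=; split.
Qed.

Lemma size_triples (T : Type) (a b c : T -> nat) (s : seq T) :
  size (flatten [seq [:: a x; b x; c x] | x <- s]) = 3 * size s.
Proof. by elim: s => //= x s ->; rewrite mulnS. Qed.

(** * From codes of edges and pairs back to the graph *)

Section Correctness.
Variables (d : Order.disp_t) (Sigma : finOrderType d) (V : finType).
Variables (E : {set V * V * Sigma}) (es : seq (V * V * Sigma)).
Hypothesis esE : edge_listing E es.

Local Notation n := #|V|.
Local Notation m := (size es).

Definition tail_code (i : nat) : nat :=
  nth 0 [seq val (enum_rank e.1.1) | e <- es] i.
Definition head_code (i : nat) : nat :=
  nth 0 [seq val (enum_rank e.1.2) | e <- es] i.
Definition label_code (i : nat) : nat :=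
  nth 0 [seq val (Order.enum_rank e.2) | e <- es] i.

Definition coded_by (u v : V) (a : Sigma) (i : nat) : Prop :=
  [/\ tail_code i = enum_rank u, head_code i = enum_rank v
    & label_code i = Order.enum_rank a].

Lemma edge_code u v a : (u, v, a) \in E -> exists2 i, i < m & coded_by u v a i.
Proof.
rewrite -(esE.2) => ein; exists (index (u, v, a) es).
  by rewrite index_mem.
rewrite /coded_by /tail_code /head_code /label_code.
by rewrite !(nth_map (u, v, a)) ?index_mem // nth_index.
Qed.

Lemma code_edge i : i < m -> exists u v a, (u, v, a) \in E /\ coded_by u v a i.
Proof.
move=> im; have [x0 _] : {x | x \in es}.
  by case: es im => // x s _; exists x; rewrite inE eqxx.
exists (nth x0 es i).1.1, (nth x0 es i).1.2, (nth x0 es i).2.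
rewrite /coded_by /tail_code /head_code /label_code !(nth_map x0) //.
by rewrite -!surjective_pairing -(esE.2) mem_nth.
Qed.

Lemma rank_eq (u v : V) :
  (val (enum_rank u) == val (enum_rank v)) = (u == v).
Proof. by rewrite (inj_eq val_inj) (inj_eq enum_rank_inj). Qed.

Lemma label_rank_eq (a b : Sigma) :
  (val (Order.enum_rank a) == val (Order.enum_rank b)) = (a == b).
Proof.
by rewrite (inj_eq val_inj) (inj_eq (@Order.EnumVal.enum_rank_inj _ _)).
Qed.

Lemma label_rank_lt (a b : Sigma) :
  (val (Order.enum_rank a) < val (Order.enum_rank b)) = (a < b)%O.
Proof.
rewrite ltnNge Order.TotalTheory.ltNge; congr (~~ _).
exact: (Order.EnumVal.le_enum_rank (@Order.TotalTheory.le_total _ Sigma) b a).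
Qed.

Definition key (x : option (V * V)) : nat :=
  if x is Some (u, v) then enum_rank u * n + enum_rank v else n * n.

(** Uniqueness of division by [n]; the root causes no clash, since the keys of pairs are less than
    [n * n]. *)
Lemma key_inj : injective key.
Proof.
have R (u : V) : enum_rank u < n by [].
move=> [[u v]|] [[u' v']|] //=.
- case/(mulnD_inj (R v) (R v')).
  by move/val_inj/enum_rank_inj=> -> /val_inj/enum_rank_inj->.
- by move=> kE; have := key_lt (R u) (R v); rewrite kE ltnn.
- by move=> kE; have := key_lt (R u') (R v'); rewrite -kE ltnn.
Qed.

Lemma has_inP (v : V) :
  reflect (exists u a, (u, v, a) \in E) (has_in head_code m (enum_rank v)).
Proof.
apply: (iffP hasP) => [[i]|[u [a /edge_code[i im [_ hi _]]]]].
  rewrite mem_iota /= => /code_edge[u [v' [a [e [_ -> _]]]]].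
  by rewrite rank_eq => /eqP vv; exists u, a; rewrite -vv.
by exists i; rewrite ?mem_iota // hi.
Qed.

Local Notation pair_arcs :=
  (arcs_upto n m tail_code head_code label_code (m * m)).

Lemma closed_arc (Q : seq nat) e f x : least_closed n pair_arcs Q ->
    e < m -> f < m -> x \in arcs n m tail_code head_code label_code e f ->
  x.1 \in Q -> x.2 \in Q.
Proof.
case=> _ closedQ _ em fm xa; apply: closedQ.
by apply/mem_arcs_upto; exists e, f.
Qed.

(** An edge into [u] and an edge out of [v] form a pair whose third arc leads from the root to this
    key. Hence only isolated vertices [v] need the flags. *)
Lemma key_in_out (Q : seq nat) u v : least_closed n pair_arcs Q ->
    (exists v' a, (v, v', a) \in E) -> has_in head_code m (enum_rank u) ->
    ~~ has_in head_code m (enum_rank v) ->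
  key (Some (u, v)) \in Q.
Proof.
move=> LQ [v' [a /edge_code[f fm [tf hf _]]]].
case/has_inP=> u' [b /edge_code[e em [te he _]]] nv.
rewrite /key -he -tf; apply: (closed_arc LQ (x := (n * n, _)) em fm);
  last by case: LQ.
by rewrite /arcs !mem_cat tf nv inE eqxx !orbT.
Qed.

(** Left to right is induction along a path from the root; right to left uses the minimality of [Q]
    for the first disjunct and Axiom 1 for the second. *)
Lemma conflict_key (Q : seq nat) u v : least_closed n pair_arcs Q ->
  conflict E (Some (u, v)) =
    (key (Some (u, v)) \in Q) ||
    (has_in head_code m (enum_rank u) && ~~ has_in head_code m (enum_rank v)).
Proof.
move=> LQ; have [rootQ _ leastQ] := LQ.
apply/idP/idP => [C|].
  pose P x := if x is Some (u, v) then (key (Some (u, v)) \in Q) ||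
    (has_in head_code m (enum_rank u) && ~~ has_in head_code m (enum_rank v))
    else true.
  suff: forall x, conflict E x -> P x by move/(_ _ C).
  apply: conflict_ind => // -[[u' v']|] [[u1 v1]|] // /andP[uv1].
    case/existsP=> a /andP[eu ev].
    (* Here [v'] has an outgoing edge, so even if the pair comes from the second disjunct, its key
       is in [Q]. *)
    suff PQ : key (Some (u', v')) \in Q -> key (Some (u1, v1)) \in Q.
      case/orP=> [/PQ|/andP[hu hv]]; first by rewrite /P => ->.
      by rewrite /P PQ //; apply: key_in_out => //; exists v1, a.
    have [e em [te he le]] := edge_code eu.
    have [f fm [tf hf lf]] := edge_code ev.
    rewrite /key -te -tf -he -hf.
    apply: (closed_arc LQ (x := (_, _)) em fm).
    by rewrite /arcs !mem_cat le lf he hf rank_eq uv1 eqxx te tf inE eqxx.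
  case/angle_failsP=> [[u' [v' [a [b [eu ev ba]]]]]|[[u' [a eu]] nv]] _.
    have [e em [te he le]] := edge_code eu.
    have [f fm [tf hf lf]] := edge_code ev.
    apply/orP; left.
    apply: (closed_arc LQ (x := (n * n, key (Some (u1, v1)))) em fm) => //.
    rewrite /arcs !mem_cat le lf he hf rank_eq label_rank_lt uv1 ba /= inE eqxx.
    by rewrite !orbT.
  apply/orP; right; apply/andP; split; first by apply/has_inP; exists u', a.
  by apply/has_inP => -[v' [b ev]]; move: (nv v' b); rewrite ev.
case/orP=> [kQ|/andP[/has_inP[u' [a eu]] /has_inP nv]]; last first.
  apply: conflict_next (conflict_None E) => /=; apply/andP; split.
    by apply/eqP => uv; apply: nv; rewrite -uv; exists u', a.
  apply/angle_failsP; right; split; first by exists u', a.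
  by move=> v' b; apply/negP => ev; apply: nv; exists v', b.
(* The codes of conflicts contain the root and are closed under the arcs. *)
suff: forall k, k \in Q -> exists2 x, key x = k & conflict E x.
  by move/(_ _ kQ) => [x /key_inj->].
move=> k; apply: (leastQ (fun k => exists2 x, key x = k & conflict E x))
  => {k kQ u v}.
  by exists None; last exact: conflict_None.
move=> x /mem_arcs_upto[e [f [em fm]]].
have [u' [u [a [eu [te he le]]]]] := code_edge em.
have [v' [v [b [ev [tf hf lf]]]]] := code_edge fm.
rewrite /arcs !mem_cat te he le tf hf lf rank_eq label_rank_eq label_rank_lt.
have rootC y : n * n = key y -> y = None by move/(@key_inj None).
case/or3P; case: ifP => //.
- case/andP=> /eqP ab uv; rewrite inE => /eqP-> /= [y ky Cy].
  exists (Some (u, v)) => //.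
  have yE : y = Some (u', v') by apply: key_inj.
  apply: conflict_next Cy; rewrite yE /= uv; apply/existsP; exists a.
  by rewrite eu ab ev.
- case/andP=> ba uv; rewrite inE => /eqP-> /= _.
  exists (Some (u, v)) => //; apply: conflict_next (conflict_None E).
  by rewrite /= uv; apply/angle_failsP; left; exists u', v', a, b.
- move=> /has_inP nv; rewrite inE => /eqP-> /= _.
  exists (Some (u, v')) => //; apply: conflict_next (conflict_None E) => /=.
  apply/andP; split.
    by apply/eqP => uv; apply: nv; rewrite -uv; exists u', a.
  apply/angle_failsP; right; split; first by exists u', a.
  by move=> w c; apply/negP => ew; apply: nv; exists w, c.
Qed.

End Correctness.

(** * Size of the arrays and total running time *)

Definition array_size (n m : nat) : nat := 4 * ((n + m + 1) * (n + m + 1)).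

(** An array must hold all keys, all arc numbers and the input; the summand [1] in [array_size]
    keeps the last bound true for the empty graph. *)
Lemma array_size_bounds n m (B := array_size n m) :
  [/\ n < B, n * n < B, 3 * m < B & 3 * (m * m) + 2 < B].
Proof. by rewrite /B /array_size; split; nia. Qed.

Lemma setup_wp W s (n := regs s 0) (m := regs s 1) :
  array_size n m < W ->
  wp W setup (fun s' =>
    [/\ regs s' 1 = m, regs s' 2 = array_size n m, regs s' 12 = n,
        regs s' 13 = n * n & regs s' 3 = regs s 3 /\ memory s' = memory s]) s.
Proof.
rewrite /array_size /= -/n -/m => BW; splits=> //; nia.
Qed.

Definition build : cmd := Seq setup scan.
Definition build_matrix : cmd := Seq build flip.

(** The quadratic terms add up to [247 + 6 * 75], and the linear term [23 * m] is absorbed by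
    [m <= m * m]. *)
Lemma scan_time_le m : scan_time m <= 800 * (m * m + 1).
Proof.
rewrite /scan_time.
have -> : (ecost heads_cond + bcost heads_body).+1 = 23 by [].
have -> : (ecost arcs_cond + bcost arcs_body).+1 = 247 by [].
have -> : (ecost search_cond + bcost search_body).+1 = 75 by [].
have -> : bcost arcs_init = 10 by [].
have -> : bcost search_init = 26 by [].
have : m <= m * m by nia.
lia.
Qed.

Lemma flip_time_le n m : n <= 2 * m -> flip_time n <= 200 * (m * m + 1).
Proof.
move=> nm; rewrite /flip_time.
have -> : (ecost flip_cond + bcost flip_body).+1 = 25 by [].
have : n * n <= 4 * (m * m) by nia.
lia.
Qed.

(** * The run on an encoded graph *)

Section Run.
Variables (d : Order.disp_t) (Sigma : finOrderType d) (V : finType).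
Variables (E : {set V * V * Sigma}) (es : seq (V * V * Sigma)) (w C : nat).
Hypothesis esE : edge_listing E es.
Hypothesis wE : admissible_word_size C E w.
Hypothesis C_ge : 7 <= C.

Local Notation n := #|V|.
Local Notation m := (size es).
Local Notation B := (array_size n m).

Lemma size_listing : m = #|E|.
Proof. by rewrite -(card_uniqP esE.1); apply: eq_card esE.2. Qed.

(** Seven factors [N >= 2] suffice: five pay for the constant [2 ^ 5 = 8 * 4], two for the square in
    [array_size]. *)
Lemma word_bound : 8 * B <= 2 ^ w /\ #|Sigma| < 2 ^ w.
Proof.
set N := n + #|E| + #|Sigma| + 2.
have NW : N ^ 7 <= 2 ^ w.
  have NL := up_logP N (isT : 1 < 2).
  apply: leq_trans (_ : (2 ^ up_log 2 N) ^ 7 <= _); first by rewrite leq_exp2r.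
  rewrite -expnM leq_exp2l // mulnC; apply: leq_trans wE.
  by rewrite leq_mul2r C_ge orbT.
have N2 : 2 <= N by rewrite /N; lia.
have N5 : 2 ^ 5 <= N ^ 5 by rewrite leq_exp2r.
have NN : N ^ 7 = N ^ 5 * (N * N) by rewrite -[7]/(5 + 2) expnD mulnn.
have sN : n + m + 1 <= N by rewrite size_listing /N; lia.
have sN2 : (n + m + 1) * (n + m + 1) <= N * N by exact: leq_mul.
split; apply: leq_trans NW; rewrite NN.
  have : 2 ^ 5 * ((n + m + 1) * (n + m + 1)) <= N ^ 5 * (N * N).
    exact: leq_mul.
  by rewrite /array_size; lia.
have : 1 * (1 * N) <= N ^ 5 * (N * N).
  by apply: leq_mul; [apply: leq_trans N5|rewrite leq_mul2r; lia].
rewrite !mul1n; apply: leq_trans; rewrite /N; lia.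
Qed.

Local Notation tl := (tail_code es).
Local Notation hd := (head_code es).
Local Notation lb := (label_code es).

Lemma tail_code_lt i : i < m -> tl i < n.
Proof. by case/(code_edge esE) => u [v [a [_ [-> _ _]]]]. Qed.

Lemma head_code_lt i : i < m -> hd i < n.
Proof. by case/(code_edge esE) => u [v [a [_ [_ -> _]]]]. Qed.

Lemma label_code_lt i : i < m -> lb i < 2 ^ w.
Proof.
case/(code_edge esE) => u [v [a [_ [_ _ ->]]]].
by apply: ltn_trans (word_bound.2); apply: ltn_ord.
Qed.

Lemma build_runs :
  runs w build (input_state es) (900 * (m * m + 1)) (fun s' =>
    exists2 Q, least_closed n (arcs_upto n m tl hd lb (m * m)) Q
             & built n m B tl hd lb Q s').
Proof.
have [Bn Bnn Bm Bmm] := array_size_bounds n m.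
have [BW SW] := word_bound.
have BW' : B < 2 ^ w by lia.
have X : runs w build (input_state es) (bcost setup + scan_time m).+1 (fun s' =>
    exists2 Q, least_closed n (arcs_upto n m tl hd lb (m * m)) Q
             & built n m B tl hd lb Q s').
  apply: runs_seq.
    by apply: runs_wp; apply: (@setup_wp (2 ^ w) (input_state es) BW').
  move=> s /= [r1 r2 r12 r13 [r3 ms]].
  apply: (scan_runs tail_code_lt head_code_lt label_code_lt
            Bn Bnn Bm Bmm BW erefl) => //.
    have W i := nth_triples (fun e : V * V * Sigma => val (enum_rank e.1.1))
      (fun e => val (enum_rank e.1.2))
      (fun e => val (Order.enum_rank e.2)) es i.
    by split=> // i im; rewrite ms; have [] := W i.
  move=> a aB; rewrite ms nth_default // size_triples; lia.
have [t [s [X1 T H]]] := X; exists t, s; split=> //.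
apply: leq_trans T _; have -> : bcost setup = 23 by [].
by have := scan_time_le m; lia.
Qed.
End Run.

(** Tails and heads of edges exhaust [V], and there are at most [#|E|] of each. *)
Lemma card_no_isolated (d : Order.disp_t) (Sigma : finOrderType d) (V : finType)
    (E : {set V * V * Sigma}) : no_isolated_vertex E -> #|V| <= 2 * #|E|.
Proof.
move=> iso; pose A := [set e.1.1 | e in E] :|: [set e.1.2 | e in E].
have -> : #|V| = #|A|.
  rewrite -cardsT; congr #|pred_of_set _|; apply/esym/setP => v; rewrite !inE.
  have [e eE ev] := iso v; apply/orP.
  by case: ev => <-; [left|right]; apply/imsetP; exists e.
rewrite mul2n -addnn; apply: leq_trans (leq_card_setU _ _) _.
by apply: leq_add; apply: leq_imset_card.
Qed.

Theorem theorem1 :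
  (exists (build query : cmd) (C : nat),
     forall (d : Order.disp_t) (Sigma : finOrderType d) (V : finType)
            (E : {set V * V * Sigma}),
     exists R : {set V * V},
       maximum_colex_relation E R /\
       computes_lookup build query C (C * (#|E| ^ 2 + 1)) E R)
  /\
  (exists (prog : cmd) (C : nat),
     forall (d : Order.disp_t) (Sigma : finOrderType d) (V : finType)
            (E : {set V * V * Sigma}),
     no_isolated_vertex E ->
     exists R : {set V * V},
       maximum_colex_relation E R /\
       computes_matrix prog C (C * (#|E| ^ 2 + 1)) E R).
Proof.
split.
  (* The constant [900] comes from [build_runs]; it also exceeds the cost of [query] and the [7]
     required by [word_bound]. *)
  exists build, query, 900 => d Sigma V E; exists (max_colex E).
  split; first exact: max_colexP.
  move=> es w esE wE.
  have [BW _] := word_bound esE wE isT.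
  have [Bn Bnn Bm Bmm] := array_size_bounds #|V| (size es).
  have [t [s [X T [Q LQ BQ]]]] := build_runs esE wE isT.
  exists t, s; split=> //; first by rewrite -mulnn -(size_listing esE).
  move=> u v; have H := query_wp Bn Bnn Bm Bmm BW erefl
    (ltn_ord (enum_rank u)) (ltn_ord (enum_rank v)) BQ.
  have [t' [s' [X' T' r0]]] := runs_wp H; exists t', s'; split=> //.
    by apply: leq_trans T' _.
  by rewrite r0 inE (conflict_key esE _ _ LQ) negb_or.
(* [1200] covers [900] for [build], [200] for [flip] and the step joining them. *)
exists build_matrix, 1200 => d Sigma V E iso; exists (max_colex E).
split; first exact: max_colexP.
move=> es w esE wE.
have [BW _] := word_bound esE wE isT.
have [Bn Bnn Bm Bmm] := array_size_bounds #|V| (size es).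
have [t [s [X T [Q LQ HQ]]]] : runs w build_matrix (input_state es)
    (900 * (size es * size es + 1) + flip_time #|V|).+1 (fun s' =>
    exists2 Q, least_closed #|V| (arcs_upto #|V| (size es) (tail_code es)
                 (head_code es) (label_code es) (size es * size es)) Q
             & forall k, k < #|V| * #|V| ->
               memory s' (regs s' 0 + k) = (k \notin Q)).
  apply: runs_seq (build_runs esE wE isT) _ => s [Q LQ BQ].
  have [t [s' [X T H]]] := flip_runs Bn Bnn Bm Bmm BW erefl BQ.
  by exists t, s'; split=> //; exists Q.
exists t, s; split=> //.
  apply: leq_trans T _; rewrite -mulnn -(size_listing esE).
  have := card_no_isolated iso; rewrite -(size_listing esE).
  by move=> /flip_time_le; lia.
move=> u v.
rewrite HQ ?key_lt // inE (conflict_key esE _ _ LQ).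
case: (boolP (has_in _ _ _ && _)) => [/andP[hu hv]|_]; last by rewrite orbF.
rewrite (key_in_out esE LQ _ hu hv) //.
have [[[v1 v2] a] eE /= [<-|ve]] := iso v; first by exists v2, a.
by case/(has_inP esE): hv; exists v1, a; rewrite -ve.
Qed.
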